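(* The smallest positive eigenvalue $\lambda_1$ of $-\mathcal{L}$ equals $1$. Moreover, for every $f\in L^2(\nu_N)$ (that is, every function $f:E\to\mathbb{R}$, since $E$ is finite), $$\forall t\ge0,\quad\|R_tf-\nu_N(f)\|_{L^2(\nu_N)}^2\le e^{-2t}\|f-\nu_N(f)\|_{L^2(\nu_N)}^2.$$
   Context: Fix $K\in\mathbb{N}^*$, $N\in\mathbb{N}^*$ (positive integers) and $p>0$; the generator below involves division by $N-1$. Let $E=\{\eta:\{1,\dots,K\}\to\mathbb{N}:\sum_{i=1}^K\eta(i)=N\}$, and let $T_{i\to j}\eta$ be obtained from $\eta$ by decreasing $\eta(i)$ by 1 and increasing $\eta(j)$ by 1 (when $\eta(i)\ne0$; $T_{i\to i}\eta=\eta$). Let $\mathcal{L}$ be the generator on functions $f:E\to\mathbb{R}$ $$\mathcal{L}f(\eta)=\sum_{i=1}^K\eta(i)\sum_{j=1}^K\big(f(T_{i\to j}\eta)-f(\eta)\big)\Big(\frac1K+p\frac{\eta(j)}{N-1}\Big),$$ $(R_t)_{t\ge0}$ the semigroup it generates, and $\nu_N$ its unique invariant distribution, which is reversible. Write $\nu_N(f)=\int f\,d\nu_N$.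
   Formalization: The eigenvalue claim is stated for K ≥ 2 only, since for K = 1 the set E is a single point, L = 0 and there is no positive eigenvalue; for N = 1 the quotient η(j)/(N−1) is read as 0. The decay estimate is stated for all K, N ≥ 1. *)

(* Defs.v *)
From HB Require Import structures.
From mathcomp Require Import all_boot all_order all_algebra.
From mathcomp Require Import all_classical all_reals all_analysis.
Import Order.TTheory GRing.Theory Num.Theory.
Import numFieldNormedType.Exports.

Set Implicit Arguments.
Unset Strict Implicit.
Unset Printing Implicit Defensive.

Local Open Scope ring_scope.

(** The set E of the configurations of N particles on K sites.  The constraint
    on the sum forces every occupation number to be at most N, so that taking
    values in ['I_N.+1] instead of [nat] only serves to make E a [finType]. *)
Record config (K N : nat) := Config {
  occ :> {ffun 'I_K -> 'I_N.+1};
  _ : (\sum_(i < K) occ i == N)%N }.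

HB.instance Definition _ K N := [isSub for @occ K N].
HB.instance Definition _ K N := [Finite of config K N by <:].

(** [jump i j eta] is T_{i -> j} eta.  When site i is empty the move is
    meaningless and [jump i j eta] is [eta]; when it is not, the default values
    of [inord] and [insubd] are never used, see [jumpE]. *)
Definition jump (K N : nat) (i j : 'I_K) (eta : config K N) : config K N :=
  if (eta i == 0 :> nat)%N then eta
  else insubd eta [ffun k => inord (eta k - (k == i) + (k == j))%N].

Lemma jumpE (K N : nat) (i j : 'I_K) (eta : config K N) (k : 'I_K) :
  (eta i != 0 :> nat)%N ->
  jump i j eta k = (eta k - (k == i) + (k == j))%N :> nat.
Proof.
move=> etai; rewrite /jump (negPf etai).
pose g k := (eta k - (k == i) + (k == j))%N.
have sum1 (l : 'I_K) : (\sum_(k < K) (k == l) = 1)%N.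
  by rewrite (bigD1 l) //= eqxx big1 // => m /negPf ->.
have sumg : (\sum_(k < K) g k = N)%N.
  rewrite big_split /= sum1.
  have eqN : ((\sum_(k < K) (eta k - (k == i))) + \sum_(k < K) (k == i) = N)%N.
    rewrite -big_split /= -[RHS](eqP (valP eta)) /=; apply: eq_bigr => l _.
    by rewrite subnK //; case: eqP => // ->; rewrite lt0n.
  by rewrite sum1 in eqN.
have gle l : (g l < N.+1)%N by rewrite ltnS -sumg (bigD1 l) //= leq_addr.
have gE l : [ffun k => inord (g k) : 'I_N.+1] l = g l :> nat.
  by rewrite ffunE inordK.
have insE : insubd eta [ffun k => inord (g k)] = [ffun k => inord (g k)]
    :> {ffun 'I_K -> 'I_N.+1}.
  apply: insubdK; rewrite unfold_in; apply/eqP.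
  by rewrite -[RHS]sumg; apply: eq_bigr => l _; rewrite gE.
by rewrite insE gE.
Qed.

(** For N = 1 the quotient is 0 since [x / 0 = 0]; this is harmless, as the
    only particle cannot interact with another one. *)
Definition generator (R : realType) (K N : nat) (p : R)
    (f : config K N -> R) (eta : config K N) : R :=
  \sum_(i < K) (eta i)%:R *
    \sum_(j < K) (f (jump i j eta) - f eta) *
                 (K%:R^-1 + p * ((eta j)%:R / N.-1%:R)).

(** R_t = e^{tL}, as the everywhere convergent exponential series of the
    operator [generator p] on the finite-dimensional space of functions on E. *)
Definition semigroup (R : realType) (K N : nat) (p t : R)
    (f : config K N -> R) (eta : config K N) : R :=
  limn (series (fun n : nat => t ^+ n / n`!%:R * iter n (generator p) f eta)).

Definition is_distribution (R : realType) (K N : nat) (nu : config K N -> R) :=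
  (forall eta, 0 <= nu eta) /\ \sum_eta nu eta = 1.

Definition mean (R : realType) (K N : nat) (nu f : config K N -> R) : R :=
  \sum_eta nu eta * f eta.

Definition invariant_distribution (R : realType) (K N : nat) (p : R)
    (nu : config K N -> R) :=
  is_distribution nu /\
  forall t, 0 <= t -> forall f, mean nu (semigroup p t f) = mean nu f.

Definition L2norm (R : realType) (K N : nat) (nu f : config K N -> R) : R :=
  Num.sqrt (mean nu (fun eta => f eta ^+ 2)).

Definition is_eigenvalue (R : realType) (T : Type) (A : (T -> R) -> (T -> R))
    (lambda : R) :=
  exists f : T -> R,
    (exists x, f x != 0) /\ forall x, A f x = lambda * f x.

(** The existence of a positive eigenvalue is part of the assertion; it fails for
    [- generator p] when K = 1, as E is then a singleton and L = 0. *)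
Definition smallest_positive_eigenvalue (R : realType) (T : Type)
    (A : (T -> R) -> (T -> R)) (lambda1 : R) :=
  [/\ 0 < lambda1,
      is_eigenvalue A lambda1 &
      forall lambda, 0 < lambda -> is_eigenvalue A lambda ->
        lambda1 <= lambda].

(* Main.v *)
(** Write eta = xi + e_i and T_{i->j} eta = xi + e_j.  Coupling the two
    processes so that the N - 1 common particles move together shows that
    P = 1 + L / Lam contracts the seminorm max |f (T_{i->j} eta) - f eta| by the
    factor 1 - 1 / Lam, for Lam large.  Hence P^n f decays at the rate
    (1 - 1 / Lam)^n when f is centered for the reversible weight w.  As P is
    self-adjoint in L^2(w), n |-> ||P^n f||^2 is log-convex, so that this
    asymptotic rate already bounds the first step:
    ||P f|| <= (1 - 1 / Lam) ||f||, which gives <f, L f> <= - ||f||^2.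
    The eigenvalue 1 is attained at eta |-> eta(i) - N / K, and integrating the
    inequality along the semigroup gives the decay.  An invariant distribution
    nu satisfies nu (L f) = 0 for all f, so the density nu / w is harmonic, hence
    constant, and nu is itself reversible. *)

Require Import Defs.
From HB Require Import structures.
From mathcomp Require Import all_boot all_order all_algebra.
From mathcomp Require Import all_classical all_reals all_analysis.
From mathcomp Require Import ring lra zify.
Import Order.TTheory GRing.Theory Num.Theory.
Import numFieldNormedType.Exports.

Set Implicit Arguments.
Unset Strict Implicit.
Unset Printing Implicit Defensive.

Local Open Scope ring_scope.

(** * Log-convexity and the abstract spectral gap *)

(** Log-convexity makes the ratios u(n+1) / u(n) nondecreasing. If the first one, r, exceeded s,
    then r^n u(0) <= u(n) <= C s^n would keep (r / s)^n bounded, against Bernoulli's inequality. *)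
Lemma log_convex_decay (R : realType) (u : nat -> R) (C s : R) : 0 < s ->
  (forall n, 0 <= u n) -> (forall n, u n.+1 ^+ 2 <= u n * u n.+2) ->
  (forall n, u n <= C * s ^+ n) -> u 1%N <= s * u 0%N.
Proof.
move=> s0 u0 ulc uC; rewrite leNgt; apply/negP => lt10.
have u00 : 0 < u 0%N.
  rewrite lt_neqAle u0 andbT eq_sym; apply/eqP => u00.
  have := ulc 0%N; rewrite u00 mul0r => h.
  have : u 1%N ^+ 2 == 0 by rewrite eq_le h sqr_ge0.
  by rewrite sqrf_eq0 => /eqP u10; rewrite u10 u00 mulr0 ltxx in lt10.
set r := u 1%N / u 0%N.
have rs : s < r by rewrite /r ltr_pdivlMr.
have r0 : 0 < r := lt_trans s0 rs.
have step n : 0 < u n /\ r * u n <= u n.+1.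
  elim: n => [|n [un IH]]; first by split; rewrite // /r divfK ?gt_eqF.
  have un1 : 0 < u n.+1 by apply: lt_le_trans IH; rewrite mulr_gt0.
  split=> //; rewrite -(ler_pM2l un).
  apply: le_trans (ulc n); rewrite mulrCA expr2 mulrA ler_pM2r //.
have geom n : r ^+ n * u 0%N <= u n.
  elim: n => [|n IH]; first by rewrite expr0 mul1r.
  rewrite exprS -mulrA; apply: le_trans (step n).2.
  by rewrite ler_pM2l.
have bern n (x : R) : 0 <= x -> 1 + n%:R * x <= (1 + x) ^+ n.
  move=> x0; elim: n => [|n IH]; first by rewrite mul0r addr0 expr0.
  rewrite exprS -nat1r.
  apply: (@le_trans _ _ ((1 + x) * (1 + n%:R * x))).
    have : 0 <= n%:R * x * x by rewrite !mulr_ge0.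
    nra.
  by rewrite ler_pM2l //; lra.
have bnd n : 1 + n%:R * (r / s - 1) <= C / u 0%N.
  have x0 : 0 <= r / s - 1 by rewrite subr_ge0 ler_pdivlMr // mul1r ltW.
  apply: le_trans (bern n _ x0) _; rewrite addrC subrK expr_div_n.
  rewrite ler_pdivrMr ?exprn_gt0 // mulrAC ler_pdivlMr //.
  exact: le_trans (geom n) (uC n).
have d0 : 0 < r / s - 1 by rewrite subr_gt0 ltr_pdivlMr // mul1r.
set N := Num.bound `|C / u 0%N / (r / s - 1)|.
have := bnd N; have hN : C / u 0%N < N%:R * (r / s - 1).
  rewrite -ltr_pdivrMr //; apply: le_lt_trans (ler_norm _) _.
  exact: archi_boundP (normr_ge0 _).
by move=> h; have := le_lt_trans h hN; lra.
Qed.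

Section SpectralGap.
Variables (R : realType) (T : finType) (w : T -> R) (L : (T -> R) -> T -> R).
Hypothesis w_gt0 : forall x, 0 < w x.
Hypothesis L_sym : forall f g,
  \sum_x w x * (g x * L f x) = \sum_x w x * (f x * L g x).

Lemma cauchy_schwarz (f g : T -> R) :
  (\sum_x w x * (f x * g x)) ^+ 2 <=
  (\sum_x w x * f x ^+ 2) * (\sum_x w x * g x ^+ 2).
Proof.
set A := \sum_x w x * f x ^+ 2; set B := \sum_x w x * (f x * g x).
set C := \sum_x w x * g x ^+ 2.
have A0 : 0 <= A by apply: sumr_ge0 => x _; rewrite mulr_ge0 ?sqr_ge0 // ltW.
have quad t : 0 <= A * t ^+ 2 - 2 * t * B + C.
  have -> : A * t ^+ 2 - 2 * t * B + C = \sum_x w x * (t * f x - g x) ^+ 2.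
    rewrite /A /B /C mulr_suml mulr_sumr -sumrN -!big_split /=.
    by apply: eq_bigr => x _; ring.
  by apply: sumr_ge0 => x _; rewrite mulr_ge0 ?sqr_ge0 // ltW.
have [A00|An0] := eqVneq A 0.
  suff -> : B = 0 by rewrite A00 mul0r expr0n.
  rewrite /B big1 // => x _.
  have /psumr_eq0P : A = 0 by []; rewrite /A => h.
  have /eqP := h (fun i _ => mulr_ge0 (ltW (w_gt0 i)) (sqr_ge0 (f i))) x isT.
  by rewrite mulf_eq0 gt_eqF //= sqrf_eq0 => /eqP ->; rewrite mul0r mulr0.
have A1 : 0 < A by rewrite lt_neqAle eq_sym An0.
(* t = B / A minimises the quadratic. *)
have := quad (B / A); have -> : A * (B / A) ^+ 2 - 2 * (B / A) * B + C = C - B ^+ 2 / A.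
  by field.
by rewrite subr_ge0 ler_pdivrMr // mulrC.
Qed.

(* [S f M] reads "the seminorm of [f] is at most [M]"; the seminorm controls
   oscillations and is contracted by [1 + L / Lam]. *)
Variables (S : (T -> R) -> R -> Prop) (D Lam : R).
Hypothesis Lam_gt1 : 1 < Lam.
Hypothesis L1 : forall x, L (fun=> 1) x = 0.
Hypothesis S_ex : forall f, exists M, 0 <= M /\ S f M.
Hypothesis S_osc : forall f M x y, S f M -> `|f x - f y| <= D * M.
Hypothesis S_contr : forall f M, S f M ->
  S (fun x => f x + Lam^-1 * L f x) ((1 - Lam^-1) * M).

Let P (f : T -> R) x := f x + Lam^-1 * L f x.
Let rho : R := 1 - Lam^-1.
Let Lam_gt0 : 0 < Lam := lt_trans ltr01 Lam_gt1.
Let rho_gt0 : 0 < rho.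
Proof. by rewrite subr_gt0 invf_lt1. Qed.

Let P_sym f g : \sum_x w x * (g x * P f x) = \sum_x w x * (f x * P g x).
Proof.
have E u v : \sum_x w x * (v x * P u x) =
  \sum_x w x * (u x * v x) + Lam^-1 * \sum_x w x * (v x * L u x).
  by rewrite mulr_sumr -big_split /=; apply: eq_bigr => x _; rewrite /P; ring.
rewrite !E L_sym; congr (_ + _); apply: eq_bigr => x _; congr (_ * _).
by rewrite mulrC.
Qed.

Lemma symmetric_mean0 f : \sum_x w x * L f x = 0.
Proof.
under eq_bigr => x _ do rewrite -[L f x]mul1r.
by rewrite (L_sym f (fun=> 1)) big1 // => x _; rewrite L1 !mulr0.
Qed.

Let P_mean f : \sum_x w x * P f x = \sum_x w x * f x.
Proof.
rewrite /P; under eq_bigr => x _ do rewrite mulrDr mulrCA.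
by rewrite big_split /= -mulr_sumr symmetric_mean0 mulr0 addr0.
Qed.

(** For centered [f], the value f x is the w-average over y of f x - f y. *)
Let centered_bound f M x : \sum_y w y * f y = 0 -> 0 <= M -> S f M ->
  `|f x| <= D * M.
Proof.
move=> f0 M0 Sf.
have W0 : 0 < \sum_y w y.
  by rewrite (bigD1 x) //= ltr_wpDr // sumr_ge0 // => y _; exact: ltW.
have -> : f x = (\sum_y w y * (f x - f y)) / \sum_y w y.
  under eq_bigr => y _ do rewrite mulrBr.
  by rewrite sumrB f0 subr0 -mulr_suml mulrC mulKf // gt_eqF.
rewrite normrM normfV (gtr0_norm W0) ler_pdivrMr // mulrC mulr_suml.
apply: le_trans (ler_norm_sum _ _ _) _; apply: ler_sum => y _.
by rewrite normrM (gtr0_norm (w_gt0 y)) ler_pM2l // S_osc.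
Qed.

Let P_contraction f : \sum_x w x * f x = 0 ->
  \sum_x w x * P f x ^+ 2 <= rho ^+ 2 * \sum_x w x * f x ^+ 2.
Proof.
move=> f0; have [M [M0 SM]] := S_ex f.
pose u n := \sum_x w x * (iter n P f x) ^+ 2.
have mean0 n : \sum_x w x * iter n P f x = 0.
  by elim: n => [|n IH] //=; rewrite P_mean.
have Sn n : S (iter n P f) (rho ^+ n * M).
  elim: n => [|n IH] /=; first by rewrite expr0 mul1r.
  by rewrite exprS -mulrA; apply: S_contr.
apply: (@log_convex_decay _ u (\sum_x w x * (D * M) ^+ 2) (rho ^+ 2)).
- by rewrite exprn_gt0.
- by move=> n; apply: sumr_ge0 => x _; rewrite mulr_ge0 ?sqr_ge0 // ltW.
(* Symmetry moves one [P] across: ||P^(n+1) f||^2 = <P^n f, P^(n+2) f>. *)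
- move=> n; have -> : u n.+1 = \sum_x w x * (iter n P f x * iter n.+2 P f x).
    rewrite -(P_sym (iter n P f)).
    by apply: eq_bigr => x _; rewrite expr2.
  exact: cauchy_schwarz.
- move=> n; rewrite -exprM mulnC exprM mulr_suml; apply: ler_sum => x _.
  rewrite -mulrA ler_pM2l // -exprMn -real_normK ?num_real //.
  have M1 : 0 <= rho ^+ n * M by rewrite mulr_ge0 // exprn_ge0 // ltW.
  have := centered_bound x (mean0 n) M1 (Sn n).
  rewrite mulrCA [X in _ <= X -> _]mulrC => h.
  by rewrite ler_sqr ?nnegrE // (le_trans _ h).
Qed.

(** 2 rho <f, P f> <= rho^2 ||f||^2 + ||P f||^2 <= 2 rho^2 ||f||^2, while <f, P f> = ||f||^2 + <f, L
    f> / Lam and rho = 1 - 1 / Lam. *)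
Lemma spectral_gap f : \sum_x w x * f x = 0 ->
  \sum_x w x * (f x * L f x) <= - \sum_x w x * f x ^+ 2.
Proof.
move=> f0; have H := P_contraction f0.
set A := \sum_x w x * f x ^+ 2 in H *.
set B := \sum_x w x * P f x ^+ 2 in H.
have cross : 2 * rho * (\sum_x w x * (f x * P f x)) <= rho ^+ 2 * A + B.
  rewrite /A /B !mulr_sumr -big_split /=; apply: ler_sum => x _.
  have := mulr_ge0 (ltW (w_gt0 x)) (sqr_ge0 (rho * f x - P f x)); nra.
have EP : \sum_x w x * (f x * P f x) =
    A + Lam^-1 * \sum_x w x * (f x * L f x).
  by rewrite mulr_sumr -big_split /=; apply: eq_bigr => x _; rewrite /P; ring.
have : 2 * rho * (\sum_x w x * (f x * P f x)) <= 2 * rho * (rho * A) by nra.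
rewrite ler_pM2l ?mulr_gt0 // EP /rho mulrBl mul1r lerD2l -mulrN.
by rewrite ler_pM2l ?invr_gt0.
Qed.

End SpectralGap.

(** * Exponential of an operator given by a matrix *)

Lemma is_derive_fsum (R : realType) (T : finType) (F : T -> R -> R)
    (dF : T -> R) (s : R) :
  (forall x, is_derive s 1 (F x) (dF x)) ->
  is_derive s 1 (fun u => \sum_x F x u) (\sum_x dF x).
Proof.
move=> dFx; rewrite (_ : (fun _ => _) = \sum_x F x); last first.
  by apply/funext => u; rewrite fct_sumE.
by elim/big_ind2 : _ => // [|] *; [exact: is_derive_cst|exact: is_deriveD].
Qed.

Section OperatorExponential.
Variables (R : realType) (T : finType) (L : (T -> R) -> T -> R).
Variable a : T -> T -> R.
Hypothesis L_matrix : forall f x, L f x = \sum_y a x y * f y.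

(* [semigroup p] unfolds to [opexp (generator p)]. *)
Definition opexp (t : R) (f : T -> R) (x : T) : R :=
  limn (series (fun n : nat => t ^+ n / n`!%:R * iter n L f x)).

Let c f x n := iter n L f x / n`!%:R.

Let c_pseries f x t :
  series (fun n : nat => t ^+ n / n`!%:R * iter n L f x) = pseries (c f x) t.
Proof.
by congr series; apply/funext => n; rewrite /c mulrC mulrA [RHS]mulrAC.
Qed.

(** [B] and [M] are the entrywise l1 norms of the matrix and of [f]; the exponential series is then
    dominated by that of M exp(B |t|). *)
Lemma iter_bound f : exists B M : R, [/\ 0 <= B, 0 <= M &
  forall n x, `|iter n L f x| <= B ^+ n * M].
Proof.
exists (\sum_x \sum_y `|a x y|), (\sum_x `|f x|).
have B0 : 0 <= \sum_x \sum_y `|a x y|.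
  by apply: sumr_ge0 => x _; apply: sumr_ge0.
have M0 : 0 <= \sum_x `|f x| by apply: sumr_ge0.
split=> //; elim=> [|n IH] x.
  by rewrite expr0 mul1r (bigD1 x) //= lerDl sumr_ge0.
rewrite iterS L_matrix; apply: le_trans (ler_norm_sum _ _ _) _.
rewrite exprS -mulrA [X in _ <= X * _](bigD1 x) //= mulrDl ler_wpDr //.
  by rewrite mulr_ge0 ?mulr_ge0 ?exprn_ge0 // sumr_ge0 // => y _; exact: sumr_ge0.
rewrite mulr_suml; apply: ler_sum => y _.
by rewrite normrM ler_wpM2l.
Qed.

Lemma cvg_opexp f x t : cvgn (pseries (c f x) t).
Proof.
have [B [M [B0 M0 bnd]]] := iter_bound f.
apply: normed_cvg.
apply: (@series_le_cvg _ _ (M *: exp_coeff (B * `|t|))) => [n|n|n|].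
- exact: normr_ge0.
- by rewrite mulr_ge0 // exp_coeff_ge0 // mulr_ge0.
- rewrite /c /= 2!normrM normrX normfV [`|n`!%:R|]ger0_norm //.
  rewrite [leRHS](_ : _ = M * ((B * `|t|) ^+ n / n`!%:R)) // exprMn.
  rewrite mulrAC [leRHS](_ : _ = B ^+ n * M * `|t| ^+ n / n`!%:R); last by ring.
  by rewrite ler_wpM2r ?invr_ge0 // ler_wpM2r ?exprn_ge0.
- exact/is_cvg_seriesZ/is_cvg_series_exp_coeff.
Qed.

(** Differentiating in t replaces f by L f, since (n + 1) L^(n+1) f / (n + 1)! = L^n (L f) / n!. *)
Let c_diffs f x : pseries_diffs (c f x) = c (L f) x.
Proof.
apply/funext => n; rewrite /pseries_diffs /c iterSr factS natrM invfM.
by rewrite mulrCA mulVKf.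
Qed.

Lemma opexp0 f : opexp 0 f = f.
Proof.
apply/funext => x; rewrite /opexp; apply: cvg_lim => //.
(* The shifted partial sums all contain the term n = 0, and every other term vanishes at t = 0. *)
rewrite -cvg_shiftS.
apply: cvg_near_cst; near=> n.
rewrite /series /= big_nat_recl //= expr0 fact0 divr1 mul1r big1 ?addr0 // => i _.
by rewrite expr0n mul0r mul0r.
Unshelve. all: by end_near. Qed.

(** [L] is a finite sum, so it passes through the limit of the partial sums. *)
Lemma opexp_comm t f x : opexp t (L f) x = L (opexp t f) x.
Proof.
rewrite /opexp L_matrix; apply: cvg_lim => //.
have -> : series (fun n => t ^+ n / n`!%:R * iter n L (L f) x) =
  fun m => \sum_y a x y * series (fun n => t ^+ n / n`!%:R * iter n L f y) m.
  apply/funext => m; rewrite /series /=.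
  under eq_bigr => i _ do rewrite -iterSr iterS L_matrix mulr_sumr.
  rewrite exchange_big /=; apply: eq_bigr => y _; rewrite mulr_sumr.
  by apply: eq_bigr => i _; rewrite mulrCA.
apply: cvg_big => [|y _]; first exact: add_continuous.
apply: cvgMr; rewrite c_pseries; exact: cvg_opexp.
Qed.

Lemma is_derive_opexp f x (t : R) :
  is_derive t 1 (fun s : R => opexp s f x) (L (opexp t f) x).
Proof.
rewrite -opexp_comm /opexp c_pseries -c_diffs.
have -> : (fun s => limn (series (fun n => s ^+ n / n`!%:R * iter n L f x))) =
  (fun s => limn (pseries (c f x) s)).
  by apply/funext => s; rewrite c_pseries.
(* The series converges everywhere, so any radius beyond |t| will do. *)
apply: (@pseries_snd_diffs _ _ (`|t| + 1)); rewrite ?c_diffs; try exact: cvg_opexp.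
by rewrite [ltRHS]ger0_norm ?ltrDl // addr_ge0.
Qed.

(** Invariance is known only for t >= 0, so the derivative is taken at the interior point t = 1. It
    gives 0 = nu (L e^L f) = nu (e^L L f) = nu (L f). *)
Lemma opexp_invariant (nu : T -> R) :
  (forall t : R, 0 <= t -> forall f,
     \sum_x nu x * opexp t f x = \sum_x nu x * f x) ->
  forall f, \sum_x nu x * L f x = 0.
Proof.
move=> inv f.
pose G (s : R) := \sum_x nu x * opexp s f x.
have dG : is_derive (1 : R) 1 G (\sum_x nu x * L (opexp 1 f) x).
  apply: is_derive_fsum => x.
  exact: (is_deriveZ (nu x) (is_derive_opexp f x 1)).
have dG0 : is_derive (1 : R) 1 G 0.
  apply: (@near_eq_is_derive R R R (cst (\sum_x nu x * f x)) G 1 1 0).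
  near=> s; rewrite /G inv //.
  by near: s; exact: lt_le_nbhsr ltr01.
rewrite -(inv 1 ler01 (L f)).
under eq_bigr => x _ do rewrite opexp_comm.
by rewrite -(@derive_val _ _ _ _ _ _ _ dG) (@derive_val _ _ _ _ _ _ _ dG0).
Unshelve. all: by end_near. Qed.

(** In L^2(w) the density h = nu / w satisfies ||L h||^2 = <h, L (L h)> = nu (L (L h)) = 0, so h is
    harmonic; the gap applied to h minus its mean makes h constant. *)
Lemma invariant_proportional (w nu : T -> R) :
  (forall x, 0 < w x) -> (forall x, L (fun=> 1) x = 0) ->
  (forall f g, \sum_x w x * (g x * L f x) = \sum_x w x * (f x * L g x)) ->
  (forall g, \sum_x w x * g x = 0 ->
    \sum_x w x * (g x * L g x) <= - \sum_x w x * g x ^+ 2) ->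
  (forall f, \sum_x nu x * L f x = 0) -> exists k, forall x, nu x = k * w x.
Proof.
move=> w0 L1 sym gap inv.
have L_cst g k x : L (fun y => g y - k) x = L g x.
  rewrite !L_matrix; under eq_bigr => y _ do rewrite mulrBr.
  rewrite sumrB; have := L1 x; rewrite L_matrix; under eq_bigr => y _ do rewrite mulr1.
  by rewrite -mulr_suml => ->; rewrite mul0r subr0.
pose h x := nu x / w x.
have Lh x : L h x = 0.
  have : \sum_y w y * (L h y) ^+ 2 = 0.
    under eq_bigr => y _ do rewrite expr2.
    rewrite sym -[RHS](inv (L h)); apply: eq_bigr => y _.
    by rewrite mulrA /h mulrCA mulfV ?mulr1 // gt_eqF.
  move=> /psumr_eq0P => h0.
  have /eqP := h0 (fun y _ => mulr_ge0 (ltW (w0 y)) (sqr_ge0 _)) x isT.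
  by rewrite mulf_eq0 gt_eqF //= sqrf_eq0 => /eqP.
pose W := \sum_x w x; pose k := (\sum_x w x * h x) / W; exists k => x.
have W0 : 0 < W.
  by rewrite /W (bigD1 x) //= ltr_wpDr // sumr_ge0 // => y _; exact: ltW.
have g0 : \sum_y w y * (h y - k) = 0.
  under eq_bigr => y _ do rewrite mulrBr.
  by rewrite sumrB -mulr_suml /k mulrC divfK ?subrr // gt_eqF.
have := gap _ g0; under eq_bigr => y _ do rewrite L_cst Lh !mulr0.
rewrite big1 // oppr_ge0 => le0.
have pos y : true -> 0 <= w y * (h y - k) ^+ 2.
  by move=> _; rewrite mulr_ge0 ?sqr_ge0 // ltW.
have /psumr_eq0P : \sum_y w y * (h y - k) ^+ 2 = 0.
  by apply/le_anti; rewrite le0 sumr_ge0.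
move=> /(_ pos x isT) /eqP; rewrite mulf_eq0 gt_eqF //= sqrf_eq0 subr_eq0.
by move=> /eqP <-; rewrite /h divfK // gt_eqF.
Qed.

(** * Exponential decay in L^2 *)

Section Decay.
Variables (w : T -> R) (f : T -> R) (m : R).
Hypothesis L1 : forall x, L (fun=> 1) x = 0.
Hypothesis gap : forall g, \sum_x w x * g x = 0 ->
  \sum_x w x * (g x * L g x) <= - \sum_x w x * g x ^+ 2.
Hypothesis mean_flow : forall t : R, 0 <= t -> \sum_x w x * (opexp t f x - m) = 0.

(** With h = e^(s L) f - m, the function e^(2 s) ||h||^2 has derivative 2 e^(2 s) (||h||^2 + <h, L
    h>), nonpositive by the gap. *)
Lemma opexp_decay (t : R) : 0 <= t ->
  \sum_x w x * (opexp t f x - m) ^+ 2 <=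
  expR (- (2 * t)) * \sum_x w x * (f x - m) ^+ 2.
Proof.
move=> t0.
pose h s x := opexp s f x - m.
have Lh s x : L (h s) x = L (opexp s f) x.
  rewrite !L_matrix /h; under eq_bigr => y _ do rewrite mulrBr.
  rewrite sumrB; apply/eqP; rewrite subr_eq addrC -subr_eq subrr eq_sym.
  have := L1 x; rewrite L_matrix => h1.
  have : (\sum_y a x y * 1) * m == 0 by rewrite h1 mul0r.
  by rewrite mulr_suml; under eq_bigr => y _ do rewrite mulr1.
pose F (s : R) : R := expR (2 * s) * \sum_x w x * h s x ^+ 2.
have dF (s : R) : is_derive s 1 F (2 * expR (2 * s) *
    (\sum_x w x * h s x ^+ 2 + \sum_x w x * (h s x * L (h s) x))).
  have dh x : is_derive s 1 (fun s : R => w x * h s x ^+ 2)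
      (2 * (w x * (h s x * L (h s) x))).
    have d0 := is_derive_opexp f x s.
    have d1 : is_derive s 1 (fun s : R => h s x) (L (h s) x).
      by rewrite Lh -[L _ _]subr0; exact: (is_deriveB d0 (is_derive_cst m s 1)).
    have d2 := is_deriveZ (w x) (is_deriveX 2 d1).
    apply: (is_derive_eq d2); rewrite /GRing.scale /=; ring.
  have dS : is_derive s 1 (fun s : R => \sum_x w x * h s x ^+ 2)
      (\sum_x 2 * (w x * (h s x * L (h s) x))).
    exact: is_derive_fsum.
  have dE : is_derive s 1 (fun s : R => expR (2 * s)) (2 * expR (2 * s)).
    apply: is_derive_eq; rewrite /GRing.scale /=; ring.
  apply: (is_derive_eq (is_deriveM dE dS)).
  rewrite -mulr_sumr /GRing.scale /=; ring.
have Fle : F t <= F 0.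
  apply: (@ler0_derive1_nincr _ F 0 t) => // [s|].
  - rewrite in_itv /= => /andP[s0 _]; rewrite derive1E (@derive_val _ _ _ _ _ _ _ (dF s)).
    apply: mulr_ge0_le0; first by rewrite mulr_ge0 ?expR_ge0.
    by rewrite addrC -lerBrDr sub0r gap // mean_flow // ltW.
  - exact: derivable_within_continuous.
move: Fle; rewrite /F mulr0 expR0 mul1r /h opexp0 => Fle.
by rewrite expRN ler_pdivlMl ?expR_gt0.
Qed.

End Decay.
End OperatorExponential.

(** * Configurations and jumps *)

Section ConfigSpace.
Variables (K n : nat).
Notation N := n.+1.
Implicit Types (x y eta : config K N) (i j k : 'I_K).

Lemma config_eqP x y : (forall k, x k = y k :> nat) -> x = y.
Proof. by move=> h; apply/val_inj/ffunP => k; apply/val_inj/h. Qed.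

Lemma config_sum x : (\sum_k x k = N)%N.
Proof. exact: eqP (valP x). Qed.

Lemma jump_eq x y i j : (x i != 0 :> nat)%N ->
  (forall k, y k = (x k - (k == i) + (k == j))%N :> nat) -> jump i j x = y.
Proof. by move=> xi h; apply: config_eqP => k; rewrite jumpE // h. Qed.

Lemma jump_id x i : jump i i x = x.
Proof.
have [xi|xi] := eqVneq (x i : nat) 0%N; first by rewrite /jump xi.
by apply: jump_eq => // k; rewrite subnK //; case: eqP => // ->; rewrite lt0n.
Qed.

Lemma jump_neq0 x i j : (x i != 0 :> nat)%N -> (jump i j x j != 0 :> nat)%N.
Proof. by move=> xi; rewrite jumpE // eqxx addn1. Qed.

Lemma jumpK x i j : (x i != 0 :> nat)%N -> jump j i (jump i j x) = x.
Proof.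
move=> xi; apply: jump_eq; first exact: jump_neq0.
move=> k; rewrite jumpE // addnK subnK //.
by case: eqP => // ->; rewrite lt0n.
Qed.

(** Plain functions to [nat] are used because removing a particle leaves [config K N]. *)
Definition incr (g : 'I_K -> nat) i : 'I_K -> nat := fun k => (g k + (k == i))%N.
Definition decr (g : 'I_K -> nat) i : 'I_K -> nat := fun k => (g k - (k == i))%N.

Lemma sum_eq1 i : (\sum_(k < K) (k == i) = 1)%N.
Proof. by rewrite (bigD1 i) //= eqxx big1 // => k /negPf ->. Qed.

Lemma sum_incr g i : (\sum_k incr g i k = (\sum_k g k).+1)%N.
Proof. by rewrite big_split /= sum_eq1 addn1. Qed.

Lemma decrK g i : (g i != 0)%N -> incr (decr g i) i = g.
Proof.
move=> gi; apply/funext => k; rewrite /incr /decr subnK //.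
by case: eqP => // ->; rewrite lt0n.
Qed.

Lemma incrC g i j : incr (incr g i) j = incr (incr g j) i.
Proof. by apply/funext => k; rewrite /incr addnAC. Qed.

Lemma sum_decr g i : (g i != 0)%N -> ((\sum_k decr g i k).+1 = \sum_k g k)%N.
Proof. by move=> gi; rewrite -(sum_incr _ i) decrK. Qed.

Lemma incr_decrC g a i : (g a != 0)%N -> decr (incr g i) a = incr (decr g a) i.
Proof.
move=> ga; apply/funext => k; rewrite /incr /decr.
by rewrite -addnBAC //; case: eqP => // ->; rewrite lt0n.
Qed.

Lemma incrK g i : decr (incr g i) i = g.
Proof. by apply/funext => k; rewrite /incr /decr addnK. Qed.

(* [eta0] only provides the junk value of [insubd]. *)
Definition cfg eta0 (g : 'I_K -> nat) : config K N :=
  insubd eta0 [ffun k => inord (g k)].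

Lemma cfgE eta0 g k : (\sum_k g k = N)%N -> cfg eta0 g k = g k :> nat.
Proof.
move=> sg.
have gE l : [ffun k => inord (g k) : 'I_N.+1] l = g l :> nat.
  by rewrite ffunE inordK // ltnS -sg (bigD1 l) //= leq_addr.
have -> : cfg eta0 g = [ffun k => inord (g k)] :> {ffun 'I_K -> 'I_N.+1}.
  apply: insubdK; rewrite unfold_in; apply/eqP.
  by rewrite -[RHS]sg; apply: eq_bigr => l _; rewrite gE.
exact: gE.
Qed.

Lemma cfg_decr eta0 x i : (x i != 0 :> nat)%N ->
  exists2 xi : 'I_K -> nat, (\sum_k xi k = n)%N & x = cfg eta0 (incr xi i).
Proof.
move=> xi0; have sx : (\sum_k decr (fun k => x k) i k).+1 = N.
  by rewrite sum_decr // config_sum.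
exists (decr (fun k => x k) i); first by case: sx.
by apply: config_eqP => k; rewrite decrK // cfgE // config_sum.
Qed.

Lemma jump_cfg eta0 g i j : (\sum_k g k = N)%N -> (g i != 0)%N ->
  jump i j (cfg eta0 g) = cfg eta0 (incr (decr g i) j).
Proof.
move=> sg gi; apply: jump_eq; first by rewrite cfgE.
by move=> k; rewrite !cfgE // sum_incr sum_decr.
Qed.

Lemma pile_subproof i :
  (\sum_k [ffun k => if k == i then ord_max else ord0 : 'I_N.+1] k == N)%N.
Proof.
rewrite (bigD1 i) //= ffunE eqxx big1 ?addn0 // => k /negPf ki.
by rewrite ffunE ki.
Qed.

Definition pile i : config K N := Config (pile_subproof i).

Lemma pileE i : pile i i = N :> nat.
Proof. by rewrite /= ffunE eqxx. Qed.

(** At most N jumps lead from one configuration to another. *)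
Lemma jump_osc (R : realType) (f : config K N -> R) (M : R) x y :
  (forall eta i j, f (jump i j eta) - f eta <= M) -> `|f x - f y| <= N%:R * M.
Proof.
move=> fM.
(* [d], a sum of truncated differences, counts the particles that have to move. *)
have dist d : forall x y, (\sum_k (x k - y k) = d)%N -> f x - f y <= d%:R * M.
  elim: d => [|d IH] {}x {}y xyd.
    have le k : (x k <= y k)%N.
      by rewrite -subn_eq0; have /eqP := xyd; rewrite sum_nat_eq0 => /forallP /(_ k).
    suff -> : x = y by rewrite subrr mul0r.
    apply: config_eqP => k; apply/eqP; rewrite eqn_leq le /=.
    have := config_sum x; rewrite -[in RHS](config_sum y) (bigD1 k) //= [RHS](bigD1 k) //=.
    move=> e; rewrite -(leq_add2r (\sum_(l | l != k) x l)%N) e leq_add2l.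
    by apply: leq_sum => l _; exact: le.
  (* Moving a particle from a site [i] in excess to a site [j] in deficit lowers [d] by one. *)
  have [i xyi] : exists i, (y i < x i)%N.
    apply/existsP; apply: contraT; rewrite negb_exists => /forallP h.
    move: xyd; rewrite big1 // => k _; apply/eqP.
    by rewrite subn_eq0 leqNgt h.
  have [j xyj] : exists j, (x j < y j)%N.
    apply/existsP; apply: contraT; rewrite negb_exists => /forallP h.
    suff : (\sum_k y k < \sum_k x k)%N by rewrite !config_sum ltnn.
    rewrite (bigD1 i) //= [X in (_ < X)%N](bigD1 i) //=.
    rewrite -addSn leq_add // leq_sum // => k _.
    by rewrite leqNgt h.
  have xi : (x i != 0 :> nat)%N by rewrite -lt0n (leq_trans _ xyi).
  have := fM (jump i j x) j i; rewrite jumpK // => step.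
  have : f (jump i j x) - f y <= d%:R * M.
    apply: IH; apply: succn_inj; rewrite -xyd -addn1 -(sum_eq1 i) -big_split /=.
    apply: eq_bigr => k _; rewrite jumpE //.
    have [->|ki] := eqVneq k i; last have [->|kj] := eqVneq k j; last 2 first.
    - by rewrite subn0 addn0 /=; apply/eqP; rewrite eqn_leq; apply/andP; split; lia.
    - by rewrite subn0 !addn0.
    - have -> : (i == j) = false by apply/negP => /eqP ij; move: xyi xyj; rewrite ij; lia.
      lia.
  by rewrite -nat1r mulrDl mul1r; lra.
(* A site exists because N > 0, and the jump from it to itself gives the bound. *)
have M0 : 0 <= M.
  have [i _] : exists i, (x i != 0 :> nat)%N.
    apply/existsP; apply: contraT; rewrite negb_exists => /forallP h.
    have := config_sum x; rewrite big1 // => k _.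
    by have := h k; rewrite negbK => /eqP.
  by have := fM x i i; rewrite jump_id subrr.
have le x' y' : f x' - f y' <= N%:R * M.
  apply: le_trans (dist _ _ _ erefl) _; rewrite ler_wpM2r // ler_nat.
  apply: (@leq_trans (\sum_k x' k)%N); last by rewrite config_sum.
  by apply: leq_sum => k _; exact: leq_subr.
by rewrite ler_norml le andbT lerNl opprB.
Qed.

End ConfigSpace.

(** * The generator: coupling, reversibility and gap *)

Section Generator.
Variables (R : realType) (K n : nat) (p : R).
Hypothesis K_gt0 : (0 < K)%N.
Hypothesis p_gt0 : 0 < p.
Notation N := n.+1.
Notation L := (@generator R K N p).
Implicit Types (x y eta : config K N) (i j k : 'I_K) (f g : config K N -> R).

(** As N = n + 1, this is p / (N - 1). *)
Let c : R := p / n%:R.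
Let c_ge0 : 0 <= c. Proof. by rewrite divr_ge0 // ltW. Qed.

Lemma generatorE f eta : L f eta = \sum_i (eta i)%:R *
  \sum_j (f (jump i j eta) - f eta) * (K%:R^-1 + c * (eta j)%:R).
Proof.
apply: eq_bigr => i _; congr (_ * _); apply: eq_bigr => j _.
congr (_ * (_ + _)).
by rewrite /c mulrCA mulrC.
Qed.

Lemma generator1 eta : L (fun=> 1) eta = 0.
Proof.
rewrite generatorE big1 // => i _; rewrite big1 ?mulr0 // => j _.
by rewrite subrr mul0r.
Qed.

Lemma generator_matrix f eta :
  L f eta = \sum_y L (fun z => (z == y)%:R) eta * f y.
Proof.
rewrite generatorE; under [RHS]eq_bigr => y _ do rewrite generatorE mulr_suml.
rewrite [RHS]exchange_big /=; apply: eq_bigr => i _.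
under [RHS]eq_bigr => y _ do rewrite -mulrA mulr_suml.
rewrite -mulr_sumr exchange_big /=; congr (_ * _); apply: eq_bigr => j _.
have ev z : f z = \sum_y (z == y)%:R * f y.
  rewrite (bigD1 z) //= eqxx mul1r big1 ?addr0 // => y /negPf.
  by rewrite eq_sym => ->; rewrite mul0r.
rewrite (ev (jump i j eta)) (ev eta) -sumrB mulr_suml.
by apply: eq_bigr => y _; ring.
Qed.

Let rate (xi : 'I_K -> nat) k : R := K%:R^-1 + c * (xi k)%:R.

Let rate_sum xi : (\sum_k xi k = n)%N -> \sum_k rate xi k = 1 + c * n%:R.
Proof.
move=> sxi; rewrite big_split /= sumr_const card_ord -[_ *+ K]mulr_natr.
by rewrite mulVf ?pnatr_eq0 -?lt0n // -mulr_sumr -natr_sum sxi.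
Qed.

Let rate_ge0 xi k : 0 <= rate xi k.
Proof. by apply: addr_ge0; [rewrite invr_ge0 | exact: mulr_ge0]. Qed.

(* One particle is singled out at site [i]; the other [n] form [xi]. *)
Lemma generator_incr eta0 f xi i :
  (\sum_k xi k = n)%N ->
  L f (cfg eta0 (incr xi i)) =
  \sum_a (xi a)%:R * (\sum_b rate xi b *
      (f (cfg eta0 (incr (incr (decr xi a) b) i)) - f (cfg eta0 (incr xi i))) +
      c * (f (cfg eta0 (incr (incr (decr xi a) i) i)) - f (cfg eta0 (incr xi i)))) +
  \sum_b rate xi b * (f (cfg eta0 (incr xi b)) - f (cfg eta0 (incr xi i))).
Proof.
move=> sxi; have sN : (\sum_k incr xi i k = N)%N by rewrite sum_incr sxi.
rewrite generatorE.
under eq_bigr => a _ do rewrite cfgE // natrD mulrDl.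
rewrite big_split /=; congr (_ + _).
  apply: eq_bigr => a _; have [->|xia] := eqVneq (xi a) 0%N; first by rewrite !mul0r.
  congr (_ * _).
  pose df b := f (cfg eta0 (incr (incr (decr xi a) b) i)) - f (cfg eta0 (incr xi i)).
  (* The singled-out particle raises the rate towards its site [i] by [c]. *)
  transitivity (\sum_b (rate xi b * df b + (b == i)%:R * (c * df b))).
    apply: eq_bigr => b _; rewrite jump_cfg //; last by rewrite /incr addn_eq0 (negPf xia).
    rewrite incr_decrC // incrC cfgE // /df /rate natrD; ring.
  rewrite big_split /=; congr (_ + _).
  rewrite (bigD1 i) //= eqxx mul1r big1 ?addr0 // => b /negPf ->.
  by rewrite mul0r.
rewrite (bigD1 i) //= eqxx mul1r [X in _ + X]big1 ?addr0 => [|a /negPf ->]; last by rewrite mul0r.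
apply: eq_bigr => b _; rewrite jump_cfg //; last by rewrite /incr eqxx addn1.
rewrite incrK cfgE // natrD.
(* The rate towards b = i also counts the particle itself, but that jump changes nothing. *)
have [->|_] := eqVneq b i; first by rewrite !subrr mul0r mulr0.
by rewrite addr0 mulrC.
Qed.

(** With D = f (T eta) - f eta, the coupling yields the bound n ((1 + c n) (M - D) + c (2 M - D)) -
    (1 + c n) D, which is exactly lip_rate (M - D) - M. *)
Definition lip_rate : R := n%:R * (1 + c * n%:R) + 1 + 2 * (c * n%:R).

(* The two copies of the process that differ by the position of one particle
   are coupled by moving the other [n] particles together. *)
Lemma generator_coupling f M eta i j :
  (forall eta i j, f (jump i j eta) - f eta <= M) -> (eta i != 0 :> nat)%N ->
  L f (jump i j eta) - L f eta <=
  lip_rate * (M - (f (jump i j eta) - f eta)) - M.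
Proof.
move=> fM /(cfg_decr eta) [xi sxi ->].
pose G h := f (cfg eta h).
have sN k : (\sum_l incr xi k l = N)%N by rewrite sum_incr sxi.
have -> : jump i j (cfg eta (incr xi i)) = cfg eta (incr xi j).
  by rewrite jump_cfg // ?incrK // /incr eqxx addn1.
have GM (h : 'I_K -> nat) k l : (\sum_m h m = n)%N -> G (incr h l) - G (incr h k) <= M.
  move=> sg; have := fM (cfg eta (incr h k)) k l.
  by rewrite jump_cfg ?incrK ?sum_incr ?sg // /incr eqxx addn1.
rewrite !generator_incr // -!/(G _).
set D := G (incr xi j) - G (incr xi i).
set A1 := (X in X + _ - _ <= _); set B1 := (X in _ + X - _ <= _).
set A2 := (X in _ - (X + _) <= _); set B2 := (X in _ - (_ + X) <= _).
have -> : A1 + B1 - (A2 + B2) = (A1 - A2) + (B1 - B2) by ring.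
(* The singled-out particle jumps to the same [b] in both copies, at a rate independent of its
   position, so the copies merge at total rate 1 + c n. *)
have -> : B1 - B2 = - ((1 + c * n%:R) * D).
  rewrite /B1 /B2 -(rate_sum sxi) mulr_suml -sumrB -sumrN; apply: eq_bigr => b _.
  by rewrite /D /G; ring.
have sxi_R : \sum_k (xi k)%:R = n%:R :> R by rewrite -natr_sum sxi.
(* Every other particle moves to the same site in both copies at [rate xi b]; the extra rate [c]
   sends it to the singled-out particle, at [j] in one copy and at [i] in the other. *)
have HA : A1 - A2 <= n%:R * ((1 + c * n%:R) * (M - D) + c * (2 * M - D)).
  rewrite /A1 /A2 -[X in _ <= X * _]sxi_R mulr_suml -sumrB; apply: ler_sum => a _.
  have [->|xia] := eqVneq (xi a) 0%N; first by rewrite !mul0r subrr.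
  rewrite -mulrBr ler_wpM2l // -(rate_sum sxi) mulr_suml.
  have sd k : (\sum_l incr (decr xi a) k l = n)%N by rewrite sum_incr sum_decr.
  set S1 := \sum_b _; set S2 := \sum_b _; set S3 := \sum_b _.
  have HS : S1 - S2 <= S3.
    rewrite -sumrB; apply: ler_sum => b _; rewrite -mulrBr ler_wpM2l //.
    have := GM _ i j (sd b); rewrite /D /G; lra.
  (* The states xi - e_a + 2 e_j and xi - e_a + 2 e_i are two jumps apart, through xi - e_a + e_i +
     e_j, hence 2 M. *)
  have HB := GM _ i j (sd j); have HC := GM _ i j (sd i).
  rewrite incrC in HB.
  have : c * (G (incr (incr (decr xi a) j) j) - G (incr (incr (decr xi a) i) i) - D)
      <= c * (2 * M - D).
    rewrite ler_wpM2l // lerD2r; move: HB HC; rewrite (incrC _ i j); lra.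
  rewrite /D /G in HS *; lra.
apply: le_trans (lerD HA (lexx _)) _.
rewrite /lip_rate -/(G _) -/(G _) -/D le_eqVlt; apply/orP; left; apply/eqP; ring.
Qed.

Lemma lip_rate_ge1 : 1 <= lip_rate.
Proof.
rewrite /lip_rate; have := mulr_ge0 c_ge0 (ler0n R n); have := ler0n R n.
set q := c * _; set m : R := n%:R; nra.
Qed.

(** The added 1 makes [Lam] exceed 1 even for n = 0, where [lip_rate] equals 1. *)
Let Lam : R := lip_rate + 1.
Let Lam_gt1 : 1 < Lam. Proof. by rewrite /Lam; have := lip_rate_ge1; lra. Qed.

(** This instantiates the seminorm [S]. A one-sided bound suffices, as a jump from a nonempty site
    is undone by the reverse jump. *)
Let lip f M := forall eta i j, f (jump i j eta) - f eta <= M.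

Let lip_ex f : exists M, 0 <= M /\ lip f M.
Proof.
exists (2 * \sum_x `|f x|); split; first by rewrite mulr_ge0 ?sumr_ge0.
have le x : `|f x| <= \sum_x `|f x| by rewrite (bigD1 x) //= lerDl sumr_ge0.
move=> eta i j; have := le (jump i j eta); have := le eta.
have := ler_norm (f (jump i j eta)); have := ler_norm (- f eta); rewrite normrN.
lra.
Qed.

Let lip_contr f M : lip f M ->
  lip (fun x => f x + Lam^-1 * L f x) ((1 - Lam^-1) * M).
Proof.
move=> fM eta i j; have L0 : 0 < Lam := lt_trans ltr01 Lam_gt1.
have I0 : 0 < Lam^-1 by rewrite invr_gt0.
have I1 : Lam^-1 < 1 by rewrite invf_lt1.
have M0 : 0 <= M by have := fM eta i i; rewrite jump_id subrr.
have [eti|eti] := eqVneq (eta i : nat) 0%N.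
  by rewrite /jump eti subrr mulr_ge0 // subr_ge0 ltW.
have H := generator_coupling j fM eti; have D := fM eta i j.
(* [Lam] may replace [lip_rate] because the factor it multiplies is nonnegative; division by [Lam]
   then cancels the increment of [f]. *)
have : Lam^-1 * (L f (jump i j eta) - L f eta) <=
    Lam^-1 * (Lam * (M - (f (jump i j eta) - f eta)) - M).
  rewrite ler_pM2l // (le_trans H) // /Lam; lra.
rewrite [leRHS]mulrBr mulKf ?gt_eqF //; lra.
Qed.

Let wt m : R := \prod_(l < m) ((K%:R^-1 + c * l%:R) / l.+1%:R).

Let wtS m : wt m.+1 * m.+1%:R = wt m * (K%:R^-1 + c * m%:R).
Proof. by rewrite /wt big_ord_recr /= -mulrA divfK // pnatr_eq0. Qed.

(** For c > 0 this is proportional to the symmetric Dirichlet-multinomial law of parameter 1 / (c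
    K). *)
Definition reversible_weight eta : R :=
  \prod_k \prod_(l < eta k) ((K%:R^-1 + c * l%:R) / l.+1%:R).

Lemma reversible_weight_gt0 eta : 0 < reversible_weight eta.
Proof.
apply: prodr_gt0 => k _; apply: prodr_gt0 => l _; rewrite divr_gt0 //.
by apply: ltr_wpDr; [exact: mulr_ge0 | rewrite invr_gt0 ltr0n].
Qed.

(** Only the factors at [i] and [j] change, and [wtS] trades the factor m + 1 for the rate 1 / K + c
    m. *)
Lemma detailed_balance eta i j : (eta i != 0 :> nat)%N ->
  reversible_weight eta * ((eta i)%:R * (K%:R^-1 + c * (eta j)%:R)) =
  reversible_weight (jump i j eta) *
    ((jump i j eta j)%:R * (K%:R^-1 + c * (jump i j eta i)%:R)).
Proof.
move=> eti; have [<-|nij] := eqVneq i j; first by rewrite jump_id.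
have Ei : jump i j eta i = (eta i).-1 :> nat.
  by rewrite jumpE // eqxx (negPf nij) addn0 subn1.
have Ej : jump i j eta j = (eta j).+1 :> nat.
  by rewrite jumpE // eqxx eq_sym (negPf nij) subn0 addn1.
have nji : j != i by rewrite eq_sym.
rewrite /reversible_weight (bigD1 i) //= (bigD1 j) //=.
rewrite [in RHS](bigD1 i) //= [in RHS](bigD1 j) //= Ei Ej.
set Q := \prod_(k | _ && _) _; set Q' := \prod_(k | _ && _) _.
have -> : Q' = Q.
  apply: eq_bigr => k /andP[/negPf ki /negPf kj].
  by have -> : jump i j eta k = eta k :> nat by rewrite jumpE // ki kj subn0 addn0.
case: (nat_of_ord (eta i)) eti => // m _; rewrite -!/(wt _) /=.
transitivity ((wt m.+1 * m.+1%:R) * (wt (eta j) * (K%:R^-1 + c * (eta j)%:R)) * Q).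
  by ring.
by rewrite wtS -[wt (eta j) * _]wtS; ring.
Qed.

(** The diagonal terms are visibly symmetric; the flow terms are exchanged by reversing each jump,
    thanks to detailed balance. *)
Lemma generator_sym f g :
  \sum_x reversible_weight x * (g x * L f x) =
  \sum_x reversible_weight x * (f x * L g x).
Proof.
pose q x i j : R := (x i)%:R * (K%:R^-1 + c * (x j)%:R).
pose w := reversible_weight.
pose flow f g x i j := w x * q x i j * (g x * f (jump i j x)).
have E u v : \sum_x w x * (v x * L u x) =
    \sum_x \sum_i \sum_j flow u v x i j -
    \sum_x \sum_i \sum_j w x * q x i j * (u x * v x).
  rewrite -sumrB; apply: eq_bigr => x _; rewrite generatorE !mulr_sumr -sumrB.
  apply: eq_bigr => i _; rewrite !mulr_sumr -sumrB; apply: eq_bigr => j _.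
  by rewrite /flow /q; ring.
rewrite !E; congr (_ - _); last first.
  do 3![apply: eq_bigr => ? _]; ring.
rewrite !pair_big /=.
(* Reversal acts on triples (configuration, source, target); those with an empty source are fixed
   and carry no flow. *)
pose s (t : (config K N * 'I_K) * 'I_K) :=
  if (t.1.1 t.1.2 == 0 :> nat)%N then t else ((jump t.1.2 t.2 t.1.1, t.2), t.1.2).
have sK : involutive s.
  move=> [[x i] j]; rewrite /s /=; have [/= ->|xi] := eqVneq (x i : nat) 0%N.
    by [].
  by rewrite /= (negPf (jump_neq0 j xi)) jumpK.
rewrite [RHS](reindex_inj (inv_inj sK)) /=; apply: eq_bigr => -[[x i] j] _.
rewrite /s /=; have [xi|xi] := eqVneq (x i : nat) 0%N.
  by rewrite /flow /q /= xi !mul0r !mulr0 !mul0r.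
rewrite /flow /q /w /= detailed_balance // jumpK //; ring.
Qed.

(** Any positive reversing weight is allowed: the lemma serves first for [reversible_weight], then
    for the invariant distribution. *)
Lemma generator_gap nu f : (forall x, 0 < nu x) ->
  (forall f g, \sum_x nu x * (g x * L f x) = \sum_x nu x * (f x * L g x)) ->
  \sum_x nu x * f x = 0 ->
  \sum_x nu x * (f x * L f x) <= - \sum_x nu x * f x ^+ 2.
Proof.
move=> nu0 sym.
apply: (spectral_gap nu0 sym Lam_gt1 generator1 lip_ex _ lip_contr).
exact: jump_osc.
Qed.

(** The gain N (1 / K + c eta(i)) and the loss (1 + c N) eta(i) share the interaction term c N
    eta(i), which cancels. *)
Lemma generator_occupation i eta :
  L (fun x => (x i)%:R - N%:R / K%:R) eta = N%:R / K%:R - (eta i)%:R.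
Proof.
rewrite generatorE.
pose r j : R := K%:R^-1 + c * (eta j)%:R.
transitivity (\sum_a (eta a)%:R * (r i - (i == a)%:R * (1 + c * N%:R))).
  apply: eq_bigr => a _; have [->|ea] := eqVneq (eta a : nat) 0%N.
    by rewrite !mul0r.
  congr (_ * _).
  (* The factor is N and not n because [eta] includes the jumping particle. *)
  have -> : 1 + c * N%:R = \sum_j r j.
    rewrite big_split /= sumr_const card_ord -[_ *+ K]mulr_natr.
    by rewrite mulVf ?pnatr_eq0 -?lt0n // -mulr_sumr -natr_sum config_sum.
  have -> : r i = \sum_j (i == j)%:R * r j.
    rewrite (bigD1 i) //= eqxx mul1r big1 ?addr0 // => j /negPf.
    by rewrite eq_sym => ->; rewrite mul0r.
  rewrite mulr_sumr -sumrB; apply: eq_bigr => j _.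
  rewrite jumpE // natrD natrB; last by case: eqP => // ->; rewrite lt0n.
  by rewrite -/(r j); ring.
under eq_bigr => a _ do rewrite mulrBr.
rewrite sumrB -mulr_suml -natr_sum config_sum.
rewrite [X in _ - X](bigD1 i) //= eqxx mul1r [X in _ - (_ + X)]big1 ?addr0; last first.
  by move=> a /negPf; rewrite eq_sym => ->; rewrite mul0r mulr0.
by rewrite /r; ring.
Qed.

End Generator.

(** * The eigenvalue 1 and convergence to equilibrium *)

Theorem mainTheorem10 (R : realType) (K N : nat) (p : R)
    (K_gt0 : (0 < K)%N) (N_gt0 : (0 < N)%N) (p_gt0 : 0 < p) :
  ((1 < K)%N ->
    smallest_positive_eigenvalue
      (fun (f : config K N -> R) (eta : config K N) => - generator p f eta) 1)
  /\
  (forall nu : config K N -> R, invariant_distribution p nu ->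
   forall (f : config K N -> R) (t : R), 0 <= t ->
     L2norm nu (fun eta => semigroup p t f eta - mean nu f) ^+ 2
       <= expR (- (2 * t)) * L2norm nu (fun eta => f eta - mean nu f) ^+ 2).
Proof.
case: N N_gt0 => // n _.
pose w := @reversible_weight R K n p.
have w0 : forall x, 0 < w x by exact: reversible_weight_gt0.
have wsym := @generator_sym R K n p.
have wgap (f : config K n.+1 -> R) := generator_gap K_gt0 p_gt0 w0 wsym (f := f).
split=> [K1|nu [[nu0 nu1] inv] f t t0].
  split=> [//||lambda l0 [f [[x fx] fE]]].
    pose i := Ordinal K_gt0.
    exists (fun x : config K n.+1 => (x i)%:R - n.+1%:R / K%:R); split=> [|eta].
      (* The value there is N (1 - 1 / K), nonzero as K > 1. *)
      exists (pile n i); rewrite pileE -[X in X - _]mulr1 -mulrBr.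
      rewrite mulf_neq0 ?pnatr_eq0 // subr_eq0 eq_sym invr_eq1.
      by rewrite pnatr_eq1 gtn_eqF.
    by rewrite generator_occupation // mul1r opprB.
  have Lf y : generator p f y = - lambda * f y by rewrite mulNr -fE opprK.
  (* L f has mean 0 and equals - lambda f with lambda nonzero; the gap therefore applies to [f]. *)
  have f0 : \sum_y w y * f y = 0.
    have := symmetric_mean0 wsym (generator1 p) f.
    under eq_bigr => y _ do rewrite Lf mulrCA.
    by rewrite -mulr_sumr => /eqP; rewrite mulf_eq0 oppr_eq0 gt_eqF //= => /eqP.
  have S0 : 0 < \sum_y w y * f y ^+ 2.
    rewrite (bigD1 x) //= ltr_wpDr //; last by rewrite mulr_gt0 // exprn_even_gt0.
    by apply: sumr_ge0 => y _; rewrite mulr_ge0 ?sqr_ge0 // ltW.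
  have := wgap f f0; have -> : \sum_y w y * (f y * generator p f y) =
      - lambda * \sum_y w y * f y ^+ 2.
    by rewrite mulr_sumr; apply: eq_bigr => y _; rewrite Lf; ring.
  by rewrite mulNr lerN2 ler_pMl.
have nuL : forall g, \sum_x nu x * generator p g x = 0.
  apply: (opexp_invariant (generator_matrix p)) => s s0 g; exact: inv.
have [k nuE] := invariant_proportional (generator_matrix p) w0 (generator1 p) wsym wgap nuL.
have k0 : 0 < k.
  have W0 : 0 <= \sum_x w x by apply: sumr_ge0 => x _; exact: ltW.
  (* Comparing total masses forces k > 0, so [nu] inherits positivity and symmetry from [w]. *)
  have kW : k * \sum_x w x = 1.
    by rewrite mulr_sumr -(eq_bigr _ (fun x _ => nuE x)) nu1.
  rewrite ltNge; apply/negP => k0; have := mulr_le0_ge0 k0 W0.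
  by rewrite kW ler10.
have nu_gt0 x : 0 < nu x by rewrite nuE mulr_gt0.
have nusym g h : \sum_x nu x * (h x * generator p g x) =
    \sum_x nu x * (g x * generator p h x).
  under eq_bigr => x _ do rewrite nuE -mulrA.
  under [RHS]eq_bigr => x _ do rewrite nuE -mulrA.
  by rewrite -!mulr_sumr wsym.
have sq g : L2norm nu g ^+ 2 = \sum_x nu x * g x ^+ 2.
  by rewrite sqr_sqrtr // sumr_ge0 // => x _; rewrite mulr_ge0 ?sqr_ge0.
rewrite !sq; apply: (opexp_decay (generator_matrix p) (generator1 p)) => // [g|s s0].
  exact: generator_gap.
(* Invariance keeps the flow centered at all times. *)
under eq_bigr => x _ do rewrite mulrBr.
by rewrite sumrB -mulr_suml nu1 mul1r; apply/eqP; rewrite subr_eq0; apply/eqP/inv.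
Qed.
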